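(* Let $K_+ = \Phi_\xi(\Delta)$ and $K_- = \Phi_\lambda(\Delta)$ be two $D$-simplices parametrised by affine bijections $\Phi_\xi : \Delta \to K_+$ and $\Phi_\lambda : \Delta \to K_-$, sharing the face $F = \Phi_\xi(f_+) = \Phi_\lambda(f_-)$, where $f_+, f_-$ are faces of $\Delta$. Choose $\pi \in S_{D+1}$ such that $$\Phi_\lambda(v_{\pi(i)}) = \Phi_\xi(v_i) \quad \text{for all } i \in f_+$$ (such $\pi$ exist, and satisfy $\pi(f_+) = f_-$). Then, for all 1-forms $\hat u_+, \hat u_- \in \Lambda^1(\Delta)$, the traces on $F$ of $u_+ = (\Phi_\xi^{-1})^* \hat u_+$ (a 1-form on $K_+$) and $u_- = (\Phi_\lambda^{-1})^* \hat u_-$ (a 1-form on $K_-$) coincide if and only if $$\operatorname{tr}_{f_-} \hat u_- = \operatorname{tr}_{f_-}\big(A_{\pi^{-1}}^* \hat u_+\big).$$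
   Context: $\Delta = [v_0,\dots,v_D] \subset \mathbb{R}^D$ is a non-degenerate $D$-simplex whose vertices carry the labels $0,\dots,D$. A face of $\Delta$ is identified with its set of vertex labels $f \subseteq \{0,\dots,D\}$ (and, when a geometric object is needed, with the convex hull of the corresponding vertices); $\dim f = |f|-1$, and faces are assumed to satisfy $\dim f \ge 1$. $S_{D+1}$ is the group of bijections of $\{0,\dots,D\}$; $\pi(f) = \{\pi(i) : i \in f\}$. For $\pi \in S_{D+1}$, $A_\pi : \Delta \to \Delta$ is the affine map with $A_\pi(v_i) = v_{\pi(i)}$ for all $i$ (so $A_{\pi^{-1}} = A_\pi^{-1}$), and $A_{\pi^{-1}}^*$ is the pullback of differential forms along $A_{\pi^{-1}}$. $\Lambda^1(\Delta)$ denotes the (smooth) differential 1-forms on $\Delta$. The trace $\operatorname{tr}_g u$ of a form on a face $g$ is its pullback by the inclusion of $g$ into the simplex; the same definition is used for the trace on the face $F$ of $K_\pm$. *)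

(* Defs.v *)
From HB Require Import structures.
From mathcomp Require Import all_boot all_order all_algebra all_fingroup.
From mathcomp Require Import all_classical all_reals all_analysis.

Set Implicit Arguments.
Unset Strict Implicit.
Unset Printing Implicit Defensive.

Import Order.TTheory GRing.Theory Num.Theory.
Import numFieldNormedType.Exports.

Local Open Scope classical_set_scope.
Local Open Scope ring_scope.

(* Points and tangent vectors of R^n are row vectors. *)

Definition affine_map (R : realType) (m n : nat) (g : 'rV[R]_m -> 'rV[R]_n) :=
  exists (B : 'M[R]_(m, n)) (b : 'rV[R]_n), forall x, g x = x *m B + b.

(* g restricts to an affine bijection K -> L, and h restricts to its inverse
   L -> K. Both are given through affine maps of the ambient spaces. If L spans
   a proper affine subspace, h is not unique, but its values on L and its
   differential along L are; affine_bijection_exists below shows that h is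
   always available when K is a simplex. *)
Definition affine_bijection (R : realType) (m n : nat)
    (K : set 'rV[R]_m) (L : set 'rV[R]_n)
    (g : 'rV[R]_m -> 'rV[R]_n) (h : 'rV[R]_n -> 'rV[R]_m) :=
  [/\ affine_map g, affine_map h, L = g @` K & forall x, K x -> h (g x) = x].

(* Vertices v_0, ..., v_D; the rows are the edge vectors v_i - v_0, i > 0. *)
Definition edge_mx (R : realType) (D n : nat) (v : 'I_D.+1 -> 'rV[R]_n) :
    'M[R]_(D, n) :=
  \matrix_(i < D) (v (lift ord0 i) - v ord0).

Definition nondegenerate_simplex (R : realType) (D n : nat)
    (v : 'I_D.+1 -> 'rV[R]_n) :=
  row_free (edge_mx v).

Definition face (R : realType) (D n : nat) (v : 'I_D.+1 -> 'rV[R]_n)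
    (f : {set 'I_D.+1}) : set 'rV[R]_n :=
  [set x | exists c : 'I_D.+1 -> R,
    [/\ forall i, 0 <= c i,
        \sum_(i in f) c i = 1 &
        x = \sum_(i in f) c i *: v i]].

Definition simplex (R : realType) (D n : nat) (v : 'I_D.+1 -> 'rV[R]_n) :
    set 'rV[R]_n :=
  face v [set: 'I_D.+1]%SET.

Lemma affine_bijection_exists (R : realType) (D n : nat)
    (v : 'I_D.+1 -> 'rV[R]_D) (g : 'rV[R]_D -> 'rV[R]_n) :
  nondegenerate_simplex v -> affine_map g ->
  (forall x y, simplex v x -> simplex v y -> g x = g y -> x = y) ->
  exists h, affine_bijection (simplex v) (g @` simplex v) g h.
Proof.
rewrite /nondegenerate_simplex row_free_unit => hv [B [b gE]] ginj.
suff Bfree : row_free B.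
  exists (fun y => (y - b) *m pinvmx B); split => //; first by exists B, b.
    by exists (pinvmx B), (- (b *m pinvmx B)) => y; rewrite mulmxBl.
  by move=> x _; rewrite gE addrK -mulmxA mulmxVp // mulmx1.
apply: inj_row_free => w wB.
pose c := w *m invmx (edge_mx v).
pose a (j : 'I_D.+1) : R :=
  if unlift ord0 j is Some k then c ord0 k else - \sum_k c ord0 k.
have a0 : a ord0 = - \sum_k c ord0 k by rewrite /a unlift_none.
have al k : a (lift ord0 k) = c ord0 k by rewrite /a liftK.
have sa : \sum_j a j = 0.
  by rewrite big_ord_recl a0 (eq_bigr _ (fun k _ => al k)) addNr.
have wE : w = \sum_j a j *: v j.
  rewrite big_ord_recl a0 (eq_bigr (fun k => c ord0 k *: v (lift ord0 k)));
    last by move=> k _; rewrite al.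
  rewrite -[w](mulmxKV hv) -/c mulmx_sum_row addrC scaleNr scaler_suml -sumrB.
  by apply: eq_bigr => k _; rewrite rowK scalerBr.
pose p j := Num.max (a j) 0; pose q j := Num.max (- a j) 0.
have pq j : a j = p j - q j.
  rewrite /p /q; case: (leP (a j) 0) => h.
    by rewrite max_l ?oppr_ge0 // sub0r opprK.
  by rewrite max_r ?subr0 // oppr_le0 ltW.
have p0 j : 0 <= p j by rewrite le_max lexx orbT.
have q0 j : 0 <= q j by rewrite le_max lexx orbT.
pose S := \sum_j p j.
have SE : S = \sum_j q j.
  by apply/eqP; rewrite -subr_eq0 -sumrB -(eq_bigr _ (fun j _ => pq j)) sa.
have [S0|S0] := eqVneq S 0.
  have pz j : p j = 0 by apply: (@psumr_eq0P _ _ predT p) => [k _|//|//]; exact: p0.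
  have qz j : q j = 0.
    by apply: (@psumr_eq0P _ _ predT q) => [k _||//]; [exact: q0|rewrite -SE].
  by rewrite wE big1 // => j _; rewrite pq pz qz subrr scale0r.
have Sge : 0 <= S by apply: sumr_ge0.
have simp (r : 'I_D.+1 -> R) : (forall j, 0 <= r j) -> \sum_j r j = S ->
    simplex v (S^-1 *: \sum_j r j *: v j).
  move=> r0 rS; exists (fun j => S^-1 * r j); split.
  - by move=> j; rewrite mulr_ge0 ?invr_ge0.
  - by rewrite (eq_bigl predT) => [|j]; rewrite ?inE // -mulr_sumr rS mulVf.
  rewrite scaler_sumr; apply: eq_big => [j|j _]; first by rewrite inE.
  by rewrite scalerA.
have /subr0_eq/eqP : \sum_j p j *: v j - \sum_j q j *: v j - w = 0.
  rewrite wE -sumrB; apply/eqP; rewrite subr_eq0; apply/eqP.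
  by apply: eq_bigr => j _; rewrite pq scalerBl.
rewrite subr_eq => /eqP pqw.
have := ginj _ _ (simp p p0 erefl) (simp q q0 (esym SE)).
rewrite !gE pqw scalerDr mulmxDl -scalemxAl wB scaler0 add0r => /(_ erefl).
move/eqP; rewrite -subr_eq0 addrK scaler_eq0 invr_eq0 (negbTE S0) /=.
by move/eqP.
Qed.

(* A_s, extended to R^D: edge_mx v is invertible, so x - v_0 has coordinates
   (x - v_0) *m invmx (edge_mx v) in the basis of edge vectors. *)
Definition vertex_perm_map (R : realType) (D : nat)
    (v : 'I_D.+1 -> 'rV[R]_D) (s : 'S_D.+1) (x : 'rV[R]_D) : 'rV[R]_D :=
  (x - v ord0) *m invmx (edge_mx v) *m edge_mx (v \o s) + v (s ord0).

Lemma vertex_perm_map_affine (R : realType) (D : nat)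
    (v : 'I_D.+1 -> 'rV[R]_D) (s : 'S_D.+1) :
  affine_map (vertex_perm_map v s).
Proof.
pose M := invmx (edge_mx v) *m edge_mx (v \o s).
exists M, (v (s ord0) - v ord0 *m M) => x.
by rewrite /vertex_perm_map -mulmxA mulmxBl addrAC addrA.
Qed.

Lemma vertex_perm_map_vertex (R : realType) (D : nat)
    (v : 'I_D.+1 -> 'rV[R]_D) (s : 'S_D.+1) (i : 'I_D.+1) :
  nondegenerate_simplex v -> vertex_perm_map v s (v i) = v (s i).
Proof.
rewrite /nondegenerate_simplex row_free_unit => hv; rewrite /vertex_perm_map.
have [j ->|->] := unliftP ord0 i; last by rewrite subrr !mul0mx add0r.
have -> : v (lift ord0 j) - v ord0 = row j (edge_mx v) by rewrite rowK.
by rewrite -row_mul mulmxV // -row_mul mul1mx rowK /= subrK.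
Qed.

(* The vectors tangent to K: the linear span of all differences of points
   of K. *)
Definition direction (R : realType) (n : nat) (K : set 'rV[R]_n) :
    set 'rV[R]_n :=
  [set w | exists (k : nat) (c : 'I_k -> R) (x y : 'I_k -> 'rV[R]_n),
    (forall i, K (x i) /\ K (y i)) /\ w = \sum_i c i *: (x i - y i)].

Fixpoint Ck (R : realType) (V W : normedModType R) (k : nat) (f : V -> W) :
    Prop :=
  if k is k'.+1 then
    (forall x, differentiable f x) /\ (forall w, Ck k' (fun x => 'd f x w))
  else continuous f.

Definition smooth (R : realType) (V W : normedModType R) (f : V -> W) :=
  forall k, Ck k f.

(* A 1-form u on a convex set K takes a point x of K and a vector w tangent
   to K to u x w. It is encoded as a total function that vanishes on all other
   pairs (x, w), so that equality of forms on K is Leibniz equality. *)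
Definition form1 (R : realType) (n : nat) := 'rV[R]_n -> 'rV[R]_n -> R.

(* Smooth up to the boundary: u is the restriction to K of a smooth form
   sum_i U_i dx_i on R^n. *)
Definition Lambda1 (R : realType) (n : nat) (K : set 'rV[R]_n) :
    set (form1 R n) :=
  [set u |
    (exists2 U : 'rV[R]_n -> 'rV[R]_n, smooth U &
      forall x w, K x -> direction K w ->
        u x w = \sum_(i < n) U x ord0 i * w ord0 i) /\
    (forall x w, ~ (K x /\ direction K w) -> u x w = 0)].

(* The pullback along g : K -> R^n, a form on K. *)
Definition pullback (R : realType) (m n : nat) (K : set 'rV[R]_m)
    (g : 'rV[R]_m -> 'rV[R]_n) (u : form1 R n) : form1 R m :=
  fun x w => if `[< K x /\ direction K w >] then u (g x) ('d g x w) else 0.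

Definition form_trace (R : realType) (n : nat) (G : set 'rV[R]_n) (u : form1 R n) :
    form1 R n :=
  pullback G (fun x => x) u.

(* Main.v *)
(* The transition map T = Phi_lambda^-1 o Phi_xi is an affine bijection from
   the face f_+ onto the face f_-, so it maps vertices to vertices. This gives
   the permutations s, and T^-1 agrees with A_(s^-1) on the vertices of f_-,
   hence on f_-. Pulling back along Phi_lambda, equality of the two traces on F
   becomes equality on f_- of u_- and the pullback of u_+ by T^-1. Affine maps that agree on a
   set have differentials that agree on its tangent directions, so there T^-1
   may be replaced by A_(s^-1). *)
Require Import Defs.
From HB Require Import structures.
From mathcomp Require Import all_boot all_order all_algebra all_fingroup.
From mathcomp Require Import primitive_action alt.
From mathcomp Require Import all_classical all_reals all_analysis.

Import Order.TTheory GRing.Theory Num.Theory.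
Import numFieldNormedType.Exports.

Local Open Scope classical_set_scope.
Local Open Scope ring_scope.

Set Implicit Arguments.
Unset Strict Implicit.
Unset Printing Implicit Defensive.

(** * Permutations with prescribed values *)

(** The symmetric group of [T] acts transitively on duplicate-free tuples of a given length, so some
    permutation carries the enumeration of [A] to its image under [t]. *)
Lemma perm_extending (T : finType) (A : {set T}) (t : T -> T) :
  {in A &, injective t} -> exists s : {perm T}, {in A, s =1 t}.
Proof.
move=> tinj; pose e := enum A.
have tr : [transitive^(size e) (Sym T), on [set: T]%SET | 'P].
  by apply: ntransitive_weak (Sym_trans T); rewrite -cardE max_card.
have dt (r : (size e).-tuple T) : uniq r -> r \in (size e).-dtuple([set: T]%SET).
  by move=> ur; rewrite inE ur; apply/fintype.subsetP => x _; rewrite inE.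
have ute : uniq (map_tuple t (in_tuple e)).
  by rewrite map_inj_in_uniq ?enum_uniq // => x y; rewrite !mem_enum; apply: tinj.
have [s _ se] := atransP2 tr (dt (in_tuple e) (enum_uniq _)) (dt _ ute).
exists s => x xA; move/(congr1 val)/eq_in_map: se => /(_ x) -> //.
by rewrite mem_enum.
Qed.

(** * Affine maps, their differentials and tangent directions *)

Lemma affine_sum (R : realType) (m n : nat) (g : 'rV[R]_m -> 'rV[R]_n)
    (I : finType) (c : I -> R) (x : I -> 'rV[R]_m) :
  affine_map g -> \sum_i c i = 1 ->
  g (\sum_i c i *: x i) = \sum_i c i *: g (x i).
Proof.
move=> [B [b gE]] c1; rewrite gE mulmx_suml -[b in LHS]scale1r -c1 scaler_suml.
by rewrite -big_split; apply: eq_bigr => i _; rewrite gE scalerDr -scalemxAl.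
Qed.

Lemma affine_sub (R : realType) (m n : nat) (B : 'M[R]_(m, n)) b
    (g : 'rV[R]_m -> 'rV[R]_n) x y :
  (forall z, g z = z *m B + b) -> g x - g y = (x - y) *m B.
Proof. by move=> gE; rewrite !gE opprD addrACA subrr addr0 mulmxBl. Qed.

Lemma affine_comp (R : realType) (m n p : nat) (h : 'rV[R]_n -> 'rV[R]_p)
    (g : 'rV[R]_m -> 'rV[R]_n) :
  affine_map h -> affine_map g -> affine_map (h \o g).
Proof.
move=> [B [b hE]] [C [c gE]]; exists (C *m B), (c *m B + b) => x.
by rewrite /= gE hE mulmxDl mulmxA addrA.
Qed.

Lemma affine_id (R : realType) (n : nat) :
  affine_map (fun x : 'rV[R]_n => x).
Proof. by exists 1%:M, 0 => x; rewrite mulmx1 addr0. Qed.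

Lemma diff_affine (R : realType) (m n : nat) (B : 'M[R]_(m, n)) b
    (g : 'rV[R]_m -> 'rV[R]_n) x w :
  (forall y, g y = y *m B + b) -> 'd g x w = w *m B.
Proof.
move=> gE.
(* Differentiability comes from the coordinate functions, since [z *m B] is the sum of the
   [z ord0 i *: row i B]; the continuity it yields is what [diff_lin] asks for. *)
have dB y : differentiable (mulmxr B : 'rV[R]_m -> 'rV[R]_n) y.
  have -> : (mulmxr B : 'rV[R]_m -> 'rV[R]_n) =
      \sum_(i < m) (fun z : 'rV[R]_m => z ord0 i *: row i B).
    by apply/funext => z; rewrite fct_sumE /= mulmx_sum_row.
  apply: differentiable_sum => i; apply: differentiableZl.
  exact: differentiable_coord.
have isB : is_diff x (mulmxr B : 'rV[R]_m -> 'rV[R]_n) (mulmxr B).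
  apply: DiffDef; first exact: dB.
  by apply: diff_lin => y; exact/differentiable_continuous/dB.
have := is_diffD isB (is_diff_cst b x).
have -> : (mulmxr B : 'rV[R]_m -> 'rV[R]_n) + cst b = g.
  by apply/funext => y; rewrite gE.
by case=> _ dg; apply: (etrans (congr1 (fun f => f w) dg)); rewrite /= addr0.
Qed.

(** The linear parts of [g] and [h] may differ, but they agree on differences of points of [K],
    hence on their span. Differentials of affine maps are constant, so the base points [x] and [y]
    may be unrelated. *)
Lemma diff_affine_direction (R : realType) (m n : nat) (K : set 'rV[R]_m)
    (g h : 'rV[R]_m -> 'rV[R]_n) x y w :
  affine_map g -> affine_map h -> (forall z, K z -> g z = h z) ->
  direction K w -> 'd g x w = 'd h y w.
Proof.
move=> [B [b gE]] [C [c hE]] gh [k [a [p [q [pq ->]]]]].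
rewrite [LHS](diff_affine x _ gE) [RHS](diff_affine y _ hE) !mulmx_suml.
apply: eq_bigr => i _; rewrite -!scalemxAl; congr (_ *: _).
have [/gh pE /gh qE] := pq i.
by rewrite -(affine_sub _ _ gE) -(affine_sub _ _ hE) pE qE.
Qed.

(** The linear part of [g] sends a difference of points to the difference of their images;
    conversely, each endpoint in the image lifts to a point of [K]. *)
Lemma direction_image (R : realType) (m n : nat) (K : set 'rV[R]_m)
    (B : 'M[R]_(m, n)) b (g : 'rV[R]_m -> 'rV[R]_n) :
  (forall x, g x = x *m B + b) ->
  direction (g @` K) = mulmxr B @` direction K.
Proof.
move=> gE; have gB p q := affine_sub p q gE.
apply/seteqP; split => [w [k [c [p [q [pq ->]]]]]|_ [w [k [c [p [q [pq ->]]]]] <-]].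
  have /choice[p' hp] : forall i, exists y, K y /\ g y = p i.
    by move=> i; have [[y Ky <-] _] := pq i; exists y.
  have /choice[q' hq] : forall i, exists y, K y /\ g y = q i.
    by move=> i; have [_ [y Ky <-]] := pq i; exists y.
  exists (\sum_i c i *: (p' i - q' i)).
    by exists k, c, p', q'; split => // i; split; [case: (hp i)|case: (hq i)].
  rewrite linear_sum; apply: eq_bigr => i _; rewrite linearZ /= -gB.
  by rewrite (hp i).2 (hq i).2.
exists k, c, (g \o p), (g \o q); split.
  by move=> i; have [Kp Kq] := pq i; split; [exists (p i)|exists (q i)].
by rewrite linear_sum; apply: eq_bigr => i _; rewrite linearZ /= gB.
Qed.

Lemma direction_sub (R : realType) (n : nat) (G K : set 'rV[R]_n) :
  G `<=` K -> direction G `<=` direction K.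
Proof.
move=> GK w [k [c [p [q [pq ->]]]]]; exists k, c, p, q; split => // i.
by have [/GK ? /GK] := pq i.
Qed.

(** * Pullbacks and traces of 1-forms *)

Lemma pullback_in (R : realType) (m n : nat) (K : set 'rV[R]_m)
    (g : 'rV[R]_m -> 'rV[R]_n) (u : form1 R n) x w :
  K x -> direction K w -> pullback K g u x w = u (g x) ('d g x w).
Proof. by move=> Kx Kw; rewrite /pullback asboolT. Qed.

Lemma pullback_eqP (R : realType) (m n p : nat) (K : set 'rV[R]_m)
    (g : 'rV[R]_m -> 'rV[R]_n) (h : 'rV[R]_m -> 'rV[R]_p)
    (u : form1 R n) (t : form1 R p) :
  pullback K g u = pullback K h t <->
  forall x w, K x -> direction K w ->
    u (g x) ('d g x w) = t (h x) ('d h x w).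
Proof.
split=> [E x w Kx Kw|E]; first by rewrite -!(pullback_in _ _ Kx Kw) E.
apply/funext => x; apply/funext => w; rewrite /pullback.
by case: asboolP => [[Kx Kw]|_]; [exact: E|reflexivity].
Qed.

Lemma eq_pullback (R : realType) (m n : nat) (K : set 'rV[R]_m)
    (g h : 'rV[R]_m -> 'rV[R]_n) (u : form1 R n) :
  affine_map g -> affine_map h -> (forall z, K z -> g z = h z) ->
  pullback K g u = pullback K h u.
Proof.
move=> ag ah gh; apply/pullback_eqP => x w Kx Kw.
exact: congr2 (gh x Kx) (diff_affine_direction x x ag ah gh Kw).
Qed.

(** The inclusion of [G] has identity differential, and pairs tangent to [G] are tangent to [K], so
    on them the inner pullback does not take its default value 0. *)
Lemma trace_pullback (R : realType) (m n : nat) (G K : set 'rV[R]_m)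
    (g : 'rV[R]_m -> 'rV[R]_n) (u : form1 R n) :
  G `<=` K -> form_trace G (pullback K g u) = pullback G g u.
Proof.
move=> GK; apply/pullback_eqP => x w Gx Gw.
have idE (y : 'rV[R]_m) : y = y *m 1%:M + 0 by rewrite mulmx1 addr0.
rewrite [X in pullback _ _ _ _ X](diff_affine x w idE) mulmx1.
exact: pullback_in (GK _ Gx) (direction_sub GK Gw).
Qed.

(** This is the chain rule, together with surjectivity: every point of the image comes from [K], and
    by [direction_image] every tangent vector of the image comes from one of [K]. *)
Lemma pullback_image (R : realType) (m n p : nat) (K : set 'rV[R]_m)
    (g : 'rV[R]_m -> 'rV[R]_n) (h k : 'rV[R]_n -> 'rV[R]_p) (u t : form1 R p) :
  affine_map g -> affine_map h -> affine_map k ->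
  pullback (g @` K) h u = pullback (g @` K) k t <->
  pullback K (h \o g) u = pullback K (k \o g) t.
Proof.
move=> [B [b gE]] [C [c hE]] [C' [c' kE]].
have dcomp (f : 'rV[R]_n -> 'rV[R]_p) M r x w :
    (forall y, f y = y *m M + r) -> 'd (f \o g) x w = 'd f (g x) (w *m B).
  move=> fE; rewrite [RHS](diff_affine _ _ fE) -mulmxA.
  apply: (@diff_affine _ _ _ _ (b *m M + r)) => y.
  by rewrite /= gE fE mulmxDl mulmxA addrA.
have dh x w := dcomp _ _ _ x w hE; have dk x w := dcomp _ _ _ x w kE.
split=> /pullback_eqP E; apply/pullback_eqP.
  move=> x w Kx Kw; apply: (etrans (congr1 _ (dh x w))).
  apply: etrans (esym (congr1 _ (dk x w))); apply: E; first by exists x.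
  by rewrite (direction_image K gE); exists w.
move=> _ + [y Ky <-]; rewrite (direction_image K gE) => _ [z Kz <-].
apply: (etrans (esym (congr1 _ (dh y z)))).
by apply: etrans (congr1 _ (dk y z)); exact: E.
Qed.

(** * Barycentric coordinates and faces *)

(** The differences [e i] sum to 0, so eliminating [e ord0] leaves a linear relation among the edge
    vectors, which are independent. *)
Lemma barycentric_unique (R : realType) (D n : nat) (v : 'I_D.+1 -> 'rV[R]_n)
    (c d : 'I_D.+1 -> R) :
  nondegenerate_simplex v -> \sum_i c i = \sum_i d i ->
  \sum_i c i *: v i = \sum_i d i *: v i -> c =1 d.
Proof.
move=> hv cd1 cdv; pose e i := c i - d i.
have e0 : \sum_i e i = 0 by rewrite sumrB cd1 subrr.
have ev : \sum_i e i *: v i = 0.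
  by under eq_bigr do rewrite scalerBl; rewrite sumrB cdv subrr.
have eM : (\row_j e (lift ord0 j)) *m edge_mx v = 0.
  rewrite mulmx_sum_row.
  under eq_bigr do rewrite mxE rowK scalerBr.
  move: ev e0; rewrite !big_ord_recl => /eqP; rewrite addrC addr_eq0 => /eqP ev.
  move/eqP; rewrite addr_eq0 => /eqP e0.
  by rewrite sumrB ev -scaler_suml e0 scaleNr opprK subrr.
have el j : e (lift ord0 j) = 0.
  have /row_free_inj := hv => /(_ 1%N _ 0) inj.
  have := congr1 (fun r : 'rV_D => r ord0 j) (inj _ (etrans eM (esym (mul0mx _ _)))).
  by rewrite !mxE.
move=> i; apply/eqP; rewrite -subr_eq0 -/(e i); apply/eqP.
have [j ->//|->] := unliftP ord0 i.
by move: e0; rewrite big_ord_recl big1 ?addr0 // => j _; exact: el.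
Qed.

Lemma vertex_inj (R : realType) (D n : nat) (v : 'I_D.+1 -> 'rV[R]_n) :
  nondegenerate_simplex v -> injective v.
Proof.
move=> hv i j vij.
have sE (k : 'I_D.+1) : \sum_l (l == k)%:R = 1 :> R.
  by rewrite (bigD1 k) //= eqxx big1 ?addr0 // => l /negbTE->.
have vE k : \sum_l (l == k)%:R *: v l = v k.
  rewrite (bigD1 k) //= eqxx scale1r big1 ?addr0 // => l /negbTE->.
  by rewrite scale0r.
have /(_ _)/(_ i) := barycentric_unique (d := fun l => (l == j)%:R) hv
  (etrans (sE i) (esym (sE j))).
rewrite !vE eqxx => /(_ vij)/eqP.
by case: (eqVneq i j) => // _; rewrite oner_eq0.
Qed.

(** Weights on all labels, extended by 0 off [f], fit the full sums of [affine_sum] and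
    [barycentric_unique]. *)
Lemma faceP (R : realType) (D n : nat) (v : 'I_D.+1 -> 'rV[R]_n) f x :
  face v f x <-> exists c : 'I_D.+1 -> R,
    [/\ forall i, 0 <= c i, forall i, i \notin f -> c i = 0,
        \sum_i c i = 1 & x = \sum_i c i *: v i].
Proof.
split=> [[c [c0 c1 ->]]|[c [c0 cf c1 ->]]].
  exists (fun i => if i \in f then c i else 0); split.
  - by move=> i; case: ifP.
  - by move=> i /negbTE->.
  - by rewrite -big_mkcond.
  by rewrite big_mkcond; apply: eq_bigr => i _; case: ifP; rewrite ?scale0r.
exists c; split => //.
  rewrite big_mkcond -c1; apply: eq_bigr => i _.
  by case: ifPn => // /cf.
rewrite [RHS]big_mkcond; apply: eq_bigr => i _.
by case: ifPn => // /cf->; rewrite scale0r.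
Qed.

Lemma face_vertex (R : realType) (D n : nat) (v : 'I_D.+1 -> 'rV[R]_n)
    (f : {set 'I_D.+1}) i :
  i \in f -> face v f (v i).
Proof.
move=> fi; exists (fun k => (k == i)%:R); split => [k||].
- by rewrite ler0n.
- by rewrite (bigD1 i) //= eqxx big1 ?addr0 // => k /andP[_ /negbTE->].
rewrite (bigD1 i) //= eqxx scale1r big1 ?addr0 // => k /andP[_ /negbTE->].
by rewrite scale0r.
Qed.

Lemma face_sub_simplex (R : realType) (D n : nat) (v : 'I_D.+1 -> 'rV[R]_n) f :
  face v f `<=` simplex v.
Proof.
move=> x /faceP[c [c0 _ c1 xE]]; apply/faceP; exists c; split => // i.
by rewrite inE.
Qed.

Lemma eq_affine_face (R : realType) (D m n : nat) (v : 'I_D.+1 -> 'rV[R]_m)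
    (f : {set 'I_D.+1})
    (g h : 'rV[R]_m -> 'rV[R]_n) :
  affine_map g -> affine_map h -> {in f, forall i, g (v i) = h (v i)} ->
  forall x, face v f x -> g x = h x.
Proof.
move=> ag ah gh x /faceP[c [_ cf c1 ->]]; rewrite !affine_sum //.
apply: eq_bigr => i _; have [fi|/cf->] := boolP (i \in f); first by rewrite gh.
by rewrite !scale0r.
Qed.

(* v i is an extreme point of the face f: writing T (v i) = sum_j c_j v_j, the
   i-th barycentric coordinate of v i = sum_j c_j S (v_j) is 1, which forces
   S (v_j) = v i for every j with c_j > 0. *)
Lemma affine_face_vertex (R : realType) (D : nat) (v : 'I_D.+1 -> 'rV[R]_D)
    (f g : {set 'I_D.+1}) (S T : 'rV[R]_D -> 'rV[R]_D) (i : 'I_D.+1) :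
  nondegenerate_simplex v -> affine_map S ->
  (forall y, face v g y -> face v f (S y) /\ T (S y) = y) ->
  face v g (T (v i)) -> S (T (v i)) = v i ->
  exists2 j, j \in g & T (v i) = v j.
Proof.
move=> hv aS hS /faceP[c [c0 cg c1 TE]] STi.
(* [b j] holds the barycentric coordinates of [S (v j)]; nothing is known of it for [j] outside [g],
   where [c j] vanishes. *)
have /choice[b hb] : forall j, exists b : 'I_D.+1 -> R, j \in g ->
    [/\ forall k, 0 <= b k, \sum_k b k = 1 & S (v j) = \sum_k b k *: v k].
  move=> j; have [jg|_] := boolP (j \in g); last by exists (fun=> 0).
  have [/faceP[b [b0 _ b1 bE]] _] := hS _ (face_vertex v jg).
  by exists b.
have cbg j (h : R) : (j \in g -> c j * h = 0) -> c j * h = 0.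
  by have [jg ->|/cg-> _] := boolP (j \in g); rewrite ?mul0r.
have cb1 : \sum_j c j * b j i = 1.
  have sE : \sum_k (k == i)%:R = 1 :> R.
    by rewrite (bigD1 i) //= eqxx big1 ?addr0 // => l /negbTE->.
  have := @barycentric_unique _ _ _ _ (fun k => \sum_j c j * b j k)
    (fun k => (k == i)%:R) hv; move=> /(_ _ _ i) ->; rewrite ?eqxx //.
    rewrite sE exchange_big /= -c1; apply: eq_bigr => j _; rewrite -mulr_sumr.
    have [jg|/cg->] := boolP (j \in g); last by rewrite mul0r.
    by have [_ -> _] := hb j jg; rewrite mulr1.
  rewrite [RHS](bigD1 i) //= eqxx scale1r [X in _ + X]big1 ?addr0; last first.
    by move=> k /negbTE->; rewrite scale0r.
  rewrite -STi TE affine_sum //.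
  under eq_bigr do rewrite scaler_suml.
  rewrite exchange_big; apply: eq_bigr => j _.
  have [jg|/cg->] := boolP (j \in g); last first.
    by rewrite scale0r big1 // => k _; rewrite mul0r scale0r.
  have [_ _ ->] := hb j jg; rewrite scaler_sumr.
  by apply: eq_bigr => k _; rewrite scalerA.
have [j cj] : exists j, c j != 0.
  apply: contrapT => cz; have := oner_neq0 R; rewrite -c1 big1 ?eqxx => // j _.
  by apply: contrapT => /eqP cj; apply: cz; exists j.
have jg : j \in g by apply: contraNT cj => /cg->.
have [bj0 bj1 bjE] := hb j jg.
have b_le1 k : k \in g -> b k i <= 1.
  move=> /hb[bk0 <- _]; rewrite (bigD1 i) //= lerDl.
  by apply: sumr_ge0.
(* The average of the [b k i] with weights [c k] is 1 and each [b k i] with [k] in [g] is at most 1,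
   so the nonnegative terms [c k * (1 - b k i)] all vanish. *)
have bji : b j i = 1.
  have /psumr_eq0P : \sum_k c k * (1 - b k i) = 0.
    by under eq_bigr do rewrite mulrBr mulr1; rewrite sumrB c1 cb1 subrr.
  move=> /(_ _)/(_ j isT) h; apply/eqP; rewrite eq_sym -subr_eq0.
  have /eqP : c j * (1 - b j i) = 0.
    apply: h => k _; have [kg|/cg->] := boolP (k \in g); last by rewrite mul0r.
    by rewrite mulr_ge0 // subr_ge0 b_le1.
  by rewrite mulf_eq0 (negbTE cj).
have bjk k : k != i -> b j k = 0.
  move=> ki; move: bj1; rewrite (bigD1 i) //= bji => /(canRL (addKr 1)).
  by rewrite addNr => /psumr_eq0P; apply.
exists j => //; have [_ <-] := hS _ (face_vertex v jg).
rewrite bjE (bigD1 i) //= bji scale1r big1 ?addr0 // => k /bjk->.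
by rewrite scale0r.
Qed.

(** * The transition between the two parametrisations *)

Theorem theorem1 (R : realType) (D N : nat)
    (v : 'I_D.+1 -> 'rV[R]_D) (hv : nondegenerate_simplex v)
    (Phi_xi Phi_lambda : 'rV[R]_D -> 'rV[R]_N)
    (Phi_xi_inv Phi_lambda_inv : 'rV[R]_N -> 'rV[R]_D)
    (Kp Km F : set 'rV[R]_N)
    (hKp : affine_bijection (simplex v) Kp Phi_xi Phi_xi_inv)
    (hKm : affine_bijection (simplex v) Km Phi_lambda Phi_lambda_inv)
    (fp fm : {set 'I_D.+1})
    (hfp : (2 <= #|fp|)%N) (hfm : (2 <= #|fm|)%N)
    (hFp : F = Phi_xi @` face v fp) (hFm : F = Phi_lambda @` face v fm) :
  (exists s : 'S_D.+1,
     forall i, i \in fp -> Phi_lambda (v (s i)) = Phi_xi (v i)) /\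
  (forall s : 'S_D.+1,
     (forall i, i \in fp -> Phi_lambda (v (s i)) = Phi_xi (v i)) ->
     (s @: fp)%SET = fm /\
     forall up um : form1 R D,
       Lambda1 (simplex v) up -> Lambda1 (simplex v) um ->
       (form_trace F (pullback Kp Phi_xi_inv up) =
        form_trace F (pullback Km Phi_lambda_inv um)
        <->
        form_trace (face v fm) um =
        form_trace (face v fm)
          (pullback (simplex v) (vertex_perm_map v (s^-1)%g) up))).
Proof.
move: hKp hKm => [agx ahx KpE xK] [agl ahl KmE lK].
(* These transition maps need not be mutually inverse on the ambient space; [ST] and [TS] below
   establish this on the two faces only. *)
pose T := Phi_lambda_inv \o Phi_xi; pose S := Phi_xi_inv \o Phi_lambda.
have aT : affine_map T by exact: affine_comp.
have aS : affine_map S by exact: affine_comp.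
have hT x : face v fp x -> face v fm (T x) /\ Phi_lambda (T x) = Phi_xi x.
  move=> fx; have : F (Phi_xi x) by rewrite hFp; exists x.
  rewrite hFm => -[y fy yx]; rewrite /T /= -yx lK //.
  exact: face_sub_simplex fy.
have hS x : face v fm x -> face v fp (S x) /\ Phi_xi (S x) = Phi_lambda x.
  move=> fx; have : F (Phi_lambda x) by rewrite hFm; exists x.
  rewrite hFp => -[y fy yx]; rewrite /S /= -yx xK //.
  exact: face_sub_simplex fy.
have ST x : face v fp x -> S (T x) = x.
  move=> fx; rewrite /S /= (hT _ fx).2 xK //; exact: face_sub_simplex fx.
have TS x : face v fm x -> T (S x) = x.
  move=> fx; rewrite /T /= (hS _ fx).2 lK //; exact: face_sub_simplex fx.
have Tv i : i \in fp -> exists2 j, j \in fm & T (v i) = v j.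
  move=> /(face_vertex v) fi.
  apply: (@affine_face_vertex _ _ _ fp fm S) => //; last exact: ST.
    by move=> y fy; split; [case: (hS _ fy)|exact: TS].
  by case: (hT _ fi).
have Sv j : j \in fm -> exists2 i, i \in fp & S (v j) = v i.
  move=> /(face_vertex v) fj.
  apply: (@affine_face_vertex _ _ _ fm fp T) => //; last exact: TS.
    by move=> y fy; split; [case: (hT _ fy)|exact: ST].
  by case: (hS _ fj).
(* Applying [Phi_lambda_inv] is legitimate because [v (s i)] lies in the simplex for any label, so
   the vertex condition already determines [s i] through [T]. *)
have vE s i : i \in fp -> Phi_lambda (v (s i)) = Phi_xi (v i) <-> v (s i) = T (v i).
  move=> fi; have fvi := face_vertex v fi; split=> [E|->]; last by case: (hT _ fvi).
  by rewrite /T /= -E lK //; apply: face_vertex; rewrite inE.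
split.
  (* The value of [t] off [fp] is arbitrary; on [fp] it is injective because [S] undoes [T]
     there. *)
  have /choice[t ht] : forall i, exists j, i \in fp -> v j = T (v i).
    move=> i; have [/Tv[j _ ->]|_] := boolP (i \in fp); first by exists j.
    by exists i.
  have [|s st] := @perm_extending _ fp t.
    move=> i j fi fj tij; apply: (vertex_inj hv).
    rewrite -[LHS](ST _ (face_vertex v fi)) -[RHS](ST _ (face_vertex v fj)).
    by rewrite -(ht i fi) -(ht j fj) tij.
  by exists s => i fi; apply/(vE s i fi); rewrite st // ht.
move=> s hs.
have sT i : i \in fp -> v (s i) = T (v i) by move=> fi; apply/vE => //; exact: hs.
have sfp : (s @: fp)%SET = fm.
  apply/setP => j; apply/imsetP/idP => [[i fi ->]|fj].
    by have [k fk Tk] := Tv i fi; rewrite (vertex_inj hv (etrans (sT i fi) Tk)).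
  have [i fi Sj] := Sv j fj; exists i => //; apply: (vertex_inj hv).
  by rewrite sT // -Sj TS //; exact: face_vertex.
split=> // up um _ _.
have FKp : F `<=` Kp.
  by rewrite hFp KpE => _ [x fx <-]; exists x => //; exact: face_sub_simplex fx.
have FKm : F `<=` Km.
  by rewrite hFm KmE => _ [x fx <-]; exists x => //; exact: face_sub_simplex fx.
have face_simplex := @face_sub_simplex _ _ _ v fm.
rewrite (trace_pullback _ up FKp) (trace_pullback _ um FKm) hFm.
rewrite (trace_pullback _ up face_simplex).
(* [S] and the permutation map agree on the vertices of [fm]: such a vertex is [v (s i)], that is
   [T (v i)], and both maps send it to [v i]. *)
have -> : pullback (face v fm) (vertex_perm_map v s^-1%g) up =
    pullback (face v fm) S up.
  apply: eq_pullback => //; first exact: vertex_perm_map_affine.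
  apply: eq_affine_face => // [|j]; first exact: vertex_perm_map_affine.
  rewrite -sfp => /imsetP[i fi ->].
  by rewrite vertex_perm_map_vertex // permK sT // ST //; exact: face_vertex.
(* The inclusion is rewritten as a composite through [Phi_lambda], so that both sides have the shape
   required by [pullback_image]. *)
have -> : form_trace (face v fm) um =
    pullback (face v fm) (Phi_lambda_inv \o Phi_lambda) um.
  apply: eq_pullback; [exact: affine_id|exact: affine_comp|move=> x fx].
  by rewrite /= lK //; exact: face_simplex.
apply: (iff_trans (pullback_image _ _ _ agl ahx ahl)).
by split=> E; exact: esym.
Qed.
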